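(* Let $q\ge 1$ be an integer, let $G$ be a simple connected graph with $n$ nodes and $m$ edges, and let $S_q(G)$ be the $q$-subdivision graph of $G$. Then $$\bar{\mathcal{K}}(S_q(G))=4\bar{\mathcal{K}}(G)+4q\,\tilde{\mathcal{K}}(G)+mq(3mq-2n+1)-n(n-1).$$
   Context: The $q$-subdivision graph $S_q(G)$ is obtained from $G$ by replacing each edge $uv$ with $q$ disjoint paths of length $2$: $ux_1v,\ldots,ux_qv$. For a connected graph $G$ with node degrees $d_i$, the resistance distance $r_{ij}$ is the effective resistance between $i$ and $j$ when each edge is replaced by a unit resistor. The additive degree-Kirchhoff index is $\bar{\mathcal K}(G)=\sum_{\{i,j\}\subseteq V(G)}(d_i+d_j)r_{ij}$ and the multiplicative degree-Kirchhoff index is $\tilde{\mathcal K}(G)=\sum_{\{i,j\}\subseteq V(G)}d_id_jr_{ij}$, the sums being over unordered pairs of nodes. *)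

(* Defs.v *)
From HB Require Import structures.
From mathcomp Require Import all_boot all_order all_algebra.
From mathcomp Require Import boolp classical_sets reals.

Set Implicit Arguments.
Unset Strict Implicit.
Unset Printing Implicit Defensive.

Import Order.TTheory GRing.Theory Num.Theory.

Local Open Scope ring_scope.

Record sgraph := SGraph {
  vertex :> finType;
  adj : rel vertex;
  adj_sym : symmetric adj;
  adj_irrefl : irreflexive adj }.

Definition edges (G : sgraph) : {set {set G}} :=
  [set [set p.1; p.2]%SET | p in [pred p : G * G | adj p.1 p.2]]%SET.

Definition connected_graph (G : sgraph) : Prop :=
  (0 < #|G|)%N /\ forall x y : G, connect (@adj G) x y.

Definition degree (G : sgraph) (x : G) : nat := #|[pred y | adj x y]|.

(* [inr (E, k)] is the middle vertex of the k-th path of length 2 replacing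
   the edge [E]; the edges of [G] itself are removed. *)
Definition subdivision_vertex (q : nat) (G : sgraph) : finType :=
  (G + {E : {set G} | E \in edges G} * 'I_q)%type.

Definition subdivision_adj (q : nat) (G : sgraph) :
    rel (subdivision_vertex q G) :=
  fun a b => match a, b with
  | inl u, inr (E, _) => u \in val E
  | inr (E, _), inl u => u \in val E
  | _, _ => false
  end.

Lemma subdivision_adj_sym q G : symmetric (@subdivision_adj q G).
Proof. by move=> [u|[E k]] [v|[F l]]. Qed.

Lemma subdivision_adj_irrefl q G : irreflexive (@subdivision_adj q G).
Proof. by move=> [u|[E k]]. Qed.

Definition subdivision (q : nat) (G : sgraph) : sgraph :=
  SGraph (@subdivision_adj_sym q G) (@subdivision_adj_irrefl q G).

(* [v] is an electric potential on [G], with unit resistors as edges, when a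
   unit current enters at [i] and leaves at [j]: by Ohm's law the current from
   [k] to a neighbour [l] is [v k - v l], and Kirchhoff's current law holds at
   every vertex. *)
Definition unit_current_potential (R : realType) (G : sgraph) (i j : G)
    (v : G -> R) : Prop :=
  forall k : G, \sum_(l | adj k l) (v k - v l) = (k == i)%:R - (k == j)%:R.

(* The default value 0 is only used when [i] and [j] are not connected; see
   [unit_current_potential_exists] and [resistanceE]. *)
Definition resistance (R : realType) (G : sgraph) (i j : G) : R :=
  xget 0 [set r | exists v : G -> R,
            unit_current_potential i j v /\ r = v i - v j]%classic.

(* The condition on [enum_rank] selects each unordered pair {i, j} with i != j
   exactly once; pairs with i = j would contribute 0. *)
Definition additive_kirchhoff (R : realType) (G : sgraph) : R :=
  \sum_(i : G) \sum_(j : G | (enum_rank i < enum_rank j)%N)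
     (degree i + degree j)%:R * resistance R i j.

Definition multiplicative_kirchhoff (R : realType) (G : sgraph) : R :=
  \sum_(i : G) \sum_(j : G | (enum_rank i < enum_rank j)%N)
     (degree i * degree j)%:R * resistance R i j.

Lemma harmonic_constant (R : realType) (G : sgraph) (v : G -> R) :
  connected_graph G ->
  (forall k : G, \sum_(l | adj k l) (v k - v l) = 0) ->
  forall x y, v x = v y.
Proof.
move=> [_ cG] hv.
have E0 : \sum_(k : G) \sum_(l | adj k l) (v k - v l) ^+ 2 = 0.
  have h1 : \sum_(k : G) \sum_(l | adj k l) v k * (v k - v l) = 0.
    by apply: big1 => k _; rewrite -mulr_sumr hv mulr0.
  have h2 : \sum_(k : G) \sum_(l | adj k l) v l * (v k - v l) = 0.
    rewrite (exchange_big_dep xpredT) //= big1 // => l _.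
    rewrite -mulr_sumr -[X in _ * X]opprK -sumrN.
    rewrite (eq_bigl (adj l)) => [|k]; last by rewrite adj_sym.
    by under eq_bigr do rewrite opprB; rewrite hv oppr0 mulr0.
  transitivity (\sum_(k : G) \sum_(l | adj k l) v k * (v k - v l)
                - \sum_(k : G) \sum_(l | adj k l) v l * (v k - v l)).
    rewrite -sumrB; apply: eq_bigr => k _.
    by rewrite -sumrB; apply: eq_bigr => l _; rewrite -mulrBl.
  by rewrite h1 h2 subr0.
have adjE x y : adj x y -> v x = v y.
  move=> xy; apply/eqP; rewrite -subr_eq0 -sqrf_eq0; move/eqP: E0.
  rewrite psumr_eq0 => [|k _]; last by apply: sumr_ge0 => l _; exact: sqr_ge0.
  move=> /allP/(_ x (mem_index_enum _))/=.
  rewrite psumr_eq0 => [|l _]; last exact: sqr_ge0.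
  by move=> /allP/(_ y (mem_index_enum _)); rewrite xy.
move=> x y; case/connectP: (cG x y) => p; elim: p x => [|z p IH] x /=.
  by move=> _ ->.
by case/andP=> /adjE -> pz /(IH _ pz).
Qed.

Lemma unit_current_potential_exists (R : realType) (G : sgraph) (i j : G) :
  connected_graph G -> exists v : G -> R, unit_current_potential i j v.
Proof.
move=> cG.
pose L : 'M[R]_#|G| := \matrix_(a, b)
  ((degree (enum_val a))%:R *+ (a == b)
   - (adj (enum_val a) (enum_val b))%:R).
have LE (w : G -> R) (k : G) :
    \sum_b L (enum_rank k) b * w (enum_val b) = \sum_(l | adj k l) (w k - w l).
  rewrite sumrB sumr_const /=.
  transitivity (\sum_(b : 'I_#|G|)
    ((degree k)%:R *+ (enum_rank k == b) * w (enum_val b)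
     - (adj k (enum_val b))%:R * w (enum_val b))).
    by apply: eq_bigr => b _; rewrite mxE enum_rankK mulrBl.
  rewrite sumrB; congr (_ - _).
    rewrite (bigD1 (enum_rank k)) //= eqxx enum_rankK big1 ?addr0.
      by rewrite mulr1n mulr_natl.
    by move=> b /negPf; rewrite eq_sym => ->; rewrite mulr0n mul0r.
  rewrite -(reindex _ (onW_bij _ (enum_val_bij G)) (P := xpredT)
    (F := fun l => (adj k l)%:R * w l)) /=.
  by rewrite [RHS]big_mkcond; apply: eq_bigr => l _; case: ifP => _;
     rewrite ?mul1r ?mul0r.
have Lsym : L^T = L.
  by apply/matrixP=> a b; rewrite !mxE eq_sym adj_sym; case: eqP => [->|].
pose u : 'rV[R]_#|G| :=
  \row_a ((enum_val a == i)%:R - (enum_val a == j)%:R).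
have uL : (u <= L)%MS.
  rewrite submxE; apply/eqP/rowP => b; rewrite [RHS]mxE.
  have cst x y : cokermx L (enum_rank x) b = cokermx L (enum_rank y) b.
    apply: (@harmonic_constant R G (fun x => cokermx L (enum_rank x) b)) => // k.
    rewrite -LE; under eq_bigr do rewrite enum_valK.
    by have /matrixP/(_ (enum_rank k) b) := mulmx_coker L; rewrite !mxE.
  rewrite mxE (reindex _ (onW_bij _ (enum_rank_bij G))) /=.
  under eq_bigr => k _ do rewrite mxE enum_rankK (cst k i).
  rewrite -mulr_suml sumrB.
  have s1 (z : G) : \sum_(k : G) (k == z)%:R = 1 :> R.
    by rewrite (bigD1 z) //= eqxx big1 ?addr0 // => k /negPf ->.
  by rewrite !s1 subrr mul0r.
case/submxP: uL => D uE; exists (fun k => D 0 (enum_rank k)) => k.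
rewrite -LE; move/rowP/(_ (enum_rank k)): uE; rewrite !mxE enum_rankK => ->.
apply: eq_bigr => b _; rewrite enum_valK mulrC.
by rewrite -{2}Lsym [L^T _ _]mxE.
Qed.

Lemma resistanceE (R : realType) (G : sgraph) (i j : G) (v : G -> R) :
  connected_graph G -> unit_current_potential i j v ->
  resistance R i j = v i - v j.
Proof.
move=> cG hv; rewrite /resistance; case: xgetP => [r _ [w [hw ->]]|]; last first.
  by move=> /(_ (v i - v j)) []; exists v.
have : w i - v i = w j - v j.
  apply: (@harmonic_constant R G (fun x => w x - v x)) => // k.
  transitivity (\sum_(l | adj k l) (w k - w l) - \sum_(l | adj k l) (v k - v l)).
    rewrite -sumrB; apply: eq_bigr => l _.
    by rewrite !opprD !addrA (addrAC (w k)).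
  by rewrite hw hv subrr.
move=> h; rewrite -[w i](subrK (v i)) h.
by rewrite addrAC (addrAC (w j)) subrr sub0r addrC.
Qed.

(* Main.v *)
Require Import Defs.
From mathcomp Require Import all_boot all_order all_algebra.
From mathcomp Require Import reals.
From mathcomp Require Import boolp ring.

Import Order.TTheory GRing.Theory Num.Theory.

Local Open Scope ring_scope.

(** Write [r] for the resistance of [G] and [S] for its q-subdivision, and
give every vertex of [S] a probability distribution on the vertices of [G]:
the point mass at [u] for an old vertex [u], half of the mass at each endpoint
of the edge [E] for a middle vertex of [E] (see [endpoint_weight]).  A
potential on [G] extends to [S] by averaging against these distributions; the
extension satisfies Kirchhoff's law at all middle vertices, and at an old
vertex its outgoing current is q/2 times the one in [G].  Hence, if [g] is a
Green function of [G] (a family of potentials, one for each source, with a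
common sink), averaging [g] in both arguments, scaling by 2/q and adding 1/2
at the pairs of equal middle vertices gives a Green function of [S]
([subdivision_greenP]).

Reading resistances off the two Green functions yields, for distinct vertices
[i], [j] of [S] with distributions [w_i], [w_j],
<<
  r_S(i,j) = 2/q (E r(w_i,w_j) - c_i - c_j) + (e_i + e_j)/2
>>
where [E r(w_i,w_j)] is the mean resistance between independent random
vertices, [c_i] is half the mean of [r] under two copies of [w_i], and [e_i]
is 1 at middle vertices and 0 elsewhere ([subdivision_resistance]).

The index is the sum of [d_i r_S(i,j)] over ordered pairs.  The total weight
that the vertices of [S] put on [u] is [1 + q d_u / 2], and [2 q d_u] when each
vertex counts with its degree, so the first term sums to 4 times the additive
index of [G] plus 4q times the multiplicative one.  The corrections [c_i] are a
quarter of the resistance of an edge at its middle vertices and 0 elsewhere,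
so their sum is known by Foster's theorem, the sum of the resistances of all
edges being [n - 1] ([foster]).  What remains only counts vertices and
edges. *)

(** * Green functions and resistances *)

(** Row [i] is a potential for a unit current from [i] to the fixed sink [o].
Rows are determined up to additive constants, which cancel in the combination
of [resistance_green]. *)
Definition is_green {R : realType} {G : sgraph} (o : G) (g : G -> G -> R) :=
  forall i, unit_current_potential i o (g i).

Lemma green_exists (R : realType) {G : sgraph} (o : G) :
  connected_graph G -> exists g : G -> G -> R, is_green o g.
Proof.
move=> cG.
have [g gP] := boolp.choice (fun i => unit_current_potential_exists R i o cG).
by exists g.
Qed.

(** By superposition, row [i] minus row [j] is a potential for a unit current
from [i] to [j]. *)
Lemma resistance_green {R : realType} {G : sgraph} {o : G} {g : G -> G -> R} :
  connected_graph G -> is_green o g ->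
  forall i j, resistance R i j = g i i + g j j - g i j - g j i.
Proof.
move=> cG gP i j.
rewrite (@resistanceE R G i j (fun k => g i k - g j k)) //; first by ring.
move=> k; transitivity (\sum_(l | adj k l) (g i k - g i l)
                        - \sum_(l | adj k l) (g j k - g j l)).
  by rewrite -sumrB; apply: eq_bigr => l _; ring.
by rewrite gP gP; ring.
Qed.

Lemma resistance_refl (R : realType) {G : sgraph} (i : G) :
  connected_graph G -> resistance R i i = 0.
Proof.
move=> cG; have [g gP] := green_exists R i cG.
by rewrite (resistance_green cG gP); ring.
Qed.

Lemma resistance_sym (R : realType) {G : sgraph} (i j : G) :
  connected_graph G -> resistance R i j = resistance R j i.
Proof.
move=> cG; have [g gP] := green_exists R i cG.
by rewrite !(resistance_green cG gP); ring.
Qed.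

Lemma sum_delta {R : realType} {T : finType} (z : T) (f : T -> R) :
  \sum_k (k == z)%:R * f k = f z.
Proof.
rewrite (bigD1 z) //= eqxx mul1r big1 ?addr0 // => k /negPf ->.
by rewrite mul0r.
Qed.

(** Raising the potential at the single vertex [i] pushes current from [i] to
its neighbours; this is used to correct averaged potentials at middle
vertices. *)
Lemma delta_laplacian (R : realType) {G : sgraph} (i k : G) :
  \sum_(l | adj k l) ((i == k)%:R - (i == l)%:R) =
  (degree k)%:R * (i == k)%:R - (adj k i)%:R :> R.
Proof.
rewrite sumrB sumr_const mulr_natl; congr (_ - _).
rewrite big_mkcond (bigD1 i) //= eqxx big1 ?addr0; first by case: (adj k i).
by move=> l /negPf; rewrite eq_sym => ->; case: ifP.
Qed.

(** Foster's theorem, each edge being counted in both directions.  Expanding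
resistances by a Green function [g], the sum is twice the trace of the
Laplacian applied to [g], and the diagonal entries are 1 except 0 at the
sink. *)
Lemma foster (R : realType) {G : sgraph} : connected_graph G ->
  \sum_(k : G) \sum_(l | adj k l) resistance R k l = 2 * (#|G|%:R - 1).
Proof.
move=> cG; have [/card_gt0P[o _] _] := cG.
have [g gP] := green_exists R o cG.
pose D := \sum_(k : G) \sum_(l | adj k l) (g k k - g k l).
have DE : D = #|G|%:R - 1.
  rewrite /D; under eq_bigr do rewrite gP eqxx.
  rewrite sumrB sumr_const; congr (_ - _).
  by under eq_bigr do rewrite -[_%:R]mulr1; rewrite sum_delta.
have DE' : \sum_(k : G) \sum_(l | adj k l) (g l l - g l k) = D.
  rewrite (exchange_big_dep xpredT) //=; apply: eq_bigr => k _.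
  by apply: eq_bigl => l; rewrite adj_sym.
rewrite -DE mulr_natl mulr2n -{2}DE' -big_split; apply: eq_bigr => k _.
rewrite -big_split; apply: eq_bigr => l _.
by rewrite (resistance_green cG gP) /=; ring.
Qed.

(** * Kirchhoff indices as sums over ordered pairs *)

(** This removes the order condition from the indices, so that their double
sums can be rearranged freely. *)
Lemma sum_unordered_pairs {R : realType} {T : finType} (F : T -> T -> R) :
  (forall i, F i i = 0) ->
  \sum_(i : T) \sum_(j : T | (enum_rank i < enum_rank j)%N) (F i j + F j i) =
  \sum_i \sum_j F i j.
Proof.
move=> F0; transitivity
  (\sum_(i : T) \sum_(j : T | (enum_rank i < enum_rank j)%N) F i j
   + \sum_(i : T) \sum_(j : T | (enum_rank j < enum_rank i)%N) F i j).
  rewrite [X in _ + X](exchange_big_dep xpredT) //= -big_split.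
  by apply: eq_bigr => i _; rewrite -big_split.
rewrite -big_split; apply: eq_bigr => i _ /=.
rewrite [RHS](bigID (fun j => (enum_rank i < enum_rank j)%N)) /=; congr (_ + _).
rewrite [RHS](bigD1 i) /= ?ltnn // F0 add0r; apply: eq_bigl => j.
by rewrite -leqNgt ltn_neqAle andbC (inj_eq val_inj) (inj_eq enum_rank_inj).
Qed.

Lemma additive_kirchhoff_ordered (R : realType) {G : sgraph} :
  connected_graph G ->
  additive_kirchhoff R G =
  \sum_(i : G) \sum_(j : G) (degree i)%:R * resistance R i j.
Proof.
move=> cG; rewrite -sum_unordered_pairs => [|i]; last first.
  by rewrite resistance_refl // mulr0.
apply: eq_bigr => i _; apply: eq_bigr => j _.
by rewrite (resistance_sym R j i) // natrD; ring.
Qed.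

Lemma multiplicative_kirchhoff_ordered (R : realType) {G : sgraph} :
  connected_graph G ->
  2 * multiplicative_kirchhoff R G =
  \sum_(i : G) \sum_(j : G)
    (degree i)%:R * (degree j)%:R * resistance R i j.
Proof.
move=> cG; rewrite -sum_unordered_pairs => [|i]; last first.
  by rewrite resistance_refl // mulr0.
rewrite mulr_sumr; apply: eq_bigr => i _; rewrite mulr_sumr.
apply: eq_bigr => j _.
by rewrite (resistance_sym R j i) // natrM; ring.
Qed.

(** * Sums over edges *)

Lemma edge_card2 {G : sgraph} {E : {set G}} : E \in edges G -> #|E| = 2%N.
Proof.
case/imsetP=> -[x y]; rewrite inE /= => xy ->; rewrite cards2.
by case: eqP xy => // ->; rewrite adj_irrefl.
Qed.

(** An edge, as a set of two vertices, forgets the orientation; symmetry of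
adjacency makes the membership test independent of it. *)
Lemma mem_edges (G : sgraph) (u v : G) : ([set u; v]%SET \in edges G) = adj u v.
Proof.
apply/imsetP/idP => [[[x y]]|uv]; last by exists (u, v).
rewrite inE /= => xy e.
have := set21 u v; have := set22 u v; rewrite e !inE.
have ne : u != v.
  apply/eqP=> uv; have : #|[set u; v]%SET| = 2%N.
    by apply: edge_card2; rewrite e; apply/imsetP; exists (x, y).
  by rewrite uv setUid cards1.
by move=> /orP[]/eqP vE /orP[]/eqP uE; move: ne; rewrite uE vE ?eqxx // adj_sym.
Qed.

(** Joining a neighbour to [u] is injective, with the edges at [u] as image. *)
Lemma sum_incident_edges {R : realType} {G : sgraph} (u : G) (F : {set G} -> R) :
  \sum_(E : {E : {set G} | E \in edges G} | u \in val E) F (val E) =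
  \sum_(v | adj u v) F [set u; v]%SET.
Proof.
transitivity (\sum_(E in edges G | u \in E) F E).
  by rewrite (big_sub_cond (mem (edges G)) (fun E : {set G} => u \in E)).
have inj : {in [pred v | adj u v] &, injective (fun v => [set u; v]%SET)}.
  move=> v w uv _ e; have := set22 u v; rewrite e => /set2P[] // vu.
  by rewrite inE vu adj_irrefl in uv.
rewrite -(big_imset F inj); apply: eq_bigl => E.
apply/andP/imsetP => [[EG uE]|[v uv ->]]; last by rewrite mem_edges set21.
case/imsetP: (EG) uE => -[x y]; rewrite inE /= => xy -> /set2P[]->.
- by exists y.
- by exists x; rewrite ?(setUC [set x]%SET) // inE adj_sym.
Qed.

(** * Extending potentials to the subdivision graph *)

Section Subdivision.

Variables (R : realType) (q : nat) (G : sgraph).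

Let S : sgraph := subdivision q G.

(** The harmonic measure of the random walk started at [a] and stopped at the
old vertices; a middle vertex has one neighbour at each end of its edge. *)
Definition endpoint_weight (a : S) (u : G) : R :=
  match a with
  | inl v => (u == v)%:R
  | inr (E, _) => (u \in val E)%:R / 2
  end.

Definition middle (a : S) : R := if a is inr _ then 1 else 0.

Definition extend (f : G -> R) (a : S) : R := \sum_u endpoint_weight a u * f u.

Lemma sum_subdivision (F : S -> R) :
  \sum_a F a = \sum_u F (inl u) +
    \sum_(E : {E : {set G} | E \in edges G}) \sum_(t < q) F (inr (E, t)).
Proof.
by rewrite big_sumType /= pair_bigA; congr (_ + _); apply: eq_bigr => -[].
Qed.

Lemma sum_adj_inl (k : G) (F : S -> R) :
  \sum_(l | adj (inl k : S) l) F l =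
  \sum_(E : {E : {set G} | E \in edges G} | k \in val E)
    \sum_(t < q) F (inr (E, t)).
Proof.
rewrite big_mkcond sum_subdivision big1 // add0r [RHS]big_mkcond /=.
by apply: eq_bigr => E _; case: ifP => // _; apply: big1.
Qed.

Lemma sum_adj_inr x (F : S -> R) :
  \sum_(l | adj (inr x : S) l) F l = \sum_(u in val x.1) F (inl u).
Proof.
case: x => E t; rewrite big_mkcond sum_subdivision [RHS]big_mkcond /=.
by rewrite [X in _ + X]big1 ?addr0 // => E' _; apply: big1.
Qed.

Lemma extend_inl f u : extend f (inl u) = f u.
Proof. exact: sum_delta. Qed.

Lemma extend_inr f x : extend f (inr x) = (\sum_(u in val x.1) f u) / 2.
Proof.
case: x => E t; rewrite mulr_suml [RHS]big_mkcond /=.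
by apply: eq_bigr => u _; case: ifP => /= -> /=; field.
Qed.

Lemma sum_weight a : \sum_u endpoint_weight a u = 1.
Proof.
transitivity (extend (fun=> 1) a); first by apply: eq_bigr => u _; rewrite mulr1.
case: a => [u|[E t]]; rewrite ?extend_inl // extend_inr /= sumr_const.
by rewrite (edge_card2 (valP E)) divff // pnatr_eq0.
Qed.

Lemma degree_inl u : degree (inl u : S) = (q * degree u)%N.
Proof.
apply/eqP; rewrite -(eqr_nat R); apply/eqP.
have degE (H : sgraph) (x : H) : (degree x)%:R = \sum_(y | adj x y) (1 : R).
  by rewrite sumr_const.
rewrite natrM !degE sum_adj_inl mulr_sumr.
rewrite -(sum_incident_edges u (fun=> q%:R * 1)).
by apply: eq_bigr => E _; rewrite /= mulr1 sumr_const card_ord.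
Qed.

Lemma degree_inr x : degree (inr x : S) = 2%N.
Proof.
apply/eqP; rewrite -(eqr_nat R); apply/eqP.
transitivity (\sum_(l | adj (inr x : S) l) (1 : R)); first by rewrite sumr_const.
by rewrite sum_adj_inr sumr_const (edge_card2 (valP x.1)).
Qed.

(** Each edge at [k] contributes [q] half-edges, and the potential drop along
each is half of the drop along the edge. *)
Lemma extend_laplacian_inl f k :
  \sum_(l | adj (inl k : S) l) (extend f (inl k) - extend f l) =
  q%:R / 2 * \sum_(l | adj k l) (f k - f l).
Proof.
rewrite sum_adj_inl mulr_sumr.
under eq_bigr => E _ do
  (under eq_bigr => t _ do rewrite extend_inl extend_inr; rewrite /=).
rewrite (sum_incident_edges k
  (fun E => \sum_(t < q) (f k - (\sum_(u in E) f u) / 2))).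
apply: eq_bigr => l kl; rewrite sumr_const card_ord big_setU1 ?inE /=; last first.
  by apply: contraTneq kl => ->; rewrite adj_irrefl.
by rewrite big_set1 -mulr_natl; field.
Qed.

Lemma extend_laplacian_inr f x :
  \sum_(l | adj (inr x : S) l) (extend f (inr x) - extend f l) = 0.
Proof.
rewrite sum_adj_inr sumrB sumr_const (edge_card2 (valP x.1)) extend_inr.
under [X in _ - X]eq_bigr do rewrite extend_inl.
by rewrite -mulr_natl; field.
Qed.

(** * Resistances of the subdivision graph *)

(** Positivity of [q] matters: without middle vertices the old vertices are
isolated. *)
Lemma subdivision_connected :
  (0 < q)%N -> connected_graph G -> connected_graph S.
Proof.
move=> q0 [/card_gt0P[o _] cG]; split; first by apply/card_gt0P; exists (inl o).
have sym : connect_sym (@adj S) by apply/sym_connect_sym/adj_sym.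
have old u v : connect (@adj S) (inl u) (inl v).
  have /connectP[p] := cG u v; elim: p u => [|w p IH] u /= => [_ ->|] //.
  case/andP=> uw pw vE; apply: connect_trans (IH _ pw vE).
  have EG : [set u; w]%SET \in edges G by rewrite mem_edges.
  pose E := exist (fun E : {set G} => E \in edges G) _ EG.
  pose x : S := inr (E, Ordinal q0).
  apply: (@connect_trans _ _ x); apply: connect1; [exact: set21 | exact: set22].
have toold a : exists u, connect (@adj S) a (inl u).
  case: a => [u|[E t]]; first by exists u.
  have /card_gt0P[u uE] : (0 < #|val E|)%N by rewrite (edge_card2 (valP E)).
  by exists u; apply: connect1.
move=> a b; have [u au] := toold a; have [v bv] := toold b.
by rewrite (connect_trans au) // (connect_trans (old u v)) // sym.
Qed.

(** Averaging in the first argument turns the unit source at [i] into sources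
distributed like its endpoint weights; for a middle vertex [i], raising the
potential at [i] by 1/2 sends exactly these two half-units of current from [i]
to its neighbours and so moves the source back to [i]. *)
Definition subdivision_green (g : G -> G -> R) (i j : S) : R :=
  2 / q%:R * extend (fun u => extend (g u) j) i + middle i / 2 * (i == j)%:R.

(** Both sides split by linearity into the extended part, where the Laplacian of
[S] reduces to that of [G], and the point correction at middle vertices. *)
Lemma subdivision_greenP o g : (0 < q)%N -> is_green o g ->
  is_green (inl o : S) (subdivision_green g).
Proof.
move=> q0 gP i k; have qN0 : q%:R != 0 :> R by rewrite pnatr_eq0 -lt0n.
transitivity (2 / q%:R * extend
    (fun u => \sum_(l | adj k l) (extend (g u) k - extend (g u) l)) i
  + middle i / 2 * \sum_(l | adj k l) ((i == k)%:R - (i == l)%:R)).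
  rewrite {2}/extend; under [X in _ * X + _]eq_bigr do rewrite mulr_sumr.
  rewrite exchange_big !mulr_sumr -big_split; apply: eq_bigr => l _ /=.
  rewrite /subdivision_green /extend.
  under [X in _ = _ * X + _]eq_bigr do rewrite mulrBr.
  by rewrite sumrB; ring.
have neq x u : (inr x == inl u :> S) = false by [].
rewrite delta_laplacian; case: k => [k|x]; last first.
  rewrite /extend big1 => [|u _]; last by rewrite extend_laplacian_inr mulr0.
  rewrite degree_inr neq; case: i => [i|y]; rewrite [middle _]/=; first by ring.
  have -> : adj (inr x : S) (inr y) = false by case: x y => [E t] [F s].
  by rewrite [inr x == inr y]eq_sym; case: (inr y == inr x) => /=; field.
transitivity (endpoint_weight i k - (k == o)%:R
    + middle i / 2 * ((degree (inl k : S))%:R * (i == inl k)%:R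
                      - (adj (inl k : S) i)%:R)).
  congr (_ + _); rewrite /extend.
  under eq_bigr do rewrite extend_laplacian_inl gP mulrCA mulrBr.
  rewrite -mulr_sumr sumrB -mulr_suml sum_weight.
  under eq_bigr do rewrite mulrC eq_sym.
  rewrite sum_delta; by field.
case: i => [i|[E t]]; first by rewrite /= mul0r mul0r addr0.
rewrite (eq_sym (inl k)) !neq [middle _]/= [endpoint_weight _ _]/= [adj _ _]/=.
rewrite [inl k == inl o]/(k == o). by case: (k \in _) => /=; field.
Qed.

(** Half the mean resistance between two independent vertices drawn from the
weights of [a]: 0 at an old vertex, a quarter of the resistance of the
edge at a middle vertex. *)
Definition edge_correction (a : S) : R :=
  2^-1 * \sum_u \sum_v
    endpoint_weight a u * endpoint_weight a v * resistance R u v.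

(** The mean of [r] under a pair of distributions is a difference of Green
function averages ([QE] below); the diagonal averages cancel against the
corrections, leaving the Green function of [S].  The formula also holds for
[i = j], where both summands vanish. *)
Lemma subdivision_resistance i j : (0 < q)%N -> connected_graph G ->
  resistance R i j =
  2 / q%:R * (\sum_u \sum_v
      endpoint_weight i u * endpoint_weight j v * resistance R u v
    - edge_correction i - edge_correction j)
  + (i != j)%:R * ((middle i + middle j) / 2).
Proof.
move=> q0 cG; have [/card_gt0P[o _] _] := cG.
have [g gP] := @green_exists R _ o cG.
rewrite (resistance_green (subdivision_connected q0 cG)
  (subdivision_greenP o g q0 gP)).
pose Q (a b : S) := extend (fun u => extend (g u) b) a.
have W1 := sum_weight.
have QE a b : \sum_u \sum_v
    endpoint_weight a u * endpoint_weight b v * resistance R u v =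
    extend (fun u => g u u) a + extend (fun u => g u u) b - Q a b - Q b a.
  transitivity (\sum_u \sum_v (
    (endpoint_weight a u * g u u) * endpoint_weight b v
    + endpoint_weight a u * (endpoint_weight b v * g v v)
    - endpoint_weight a u * (endpoint_weight b v * g u v)
    - endpoint_weight b v * (endpoint_weight a u * g v u))).
    apply: eq_bigr => u _; apply: eq_bigr => v _.
    by rewrite (resistance_green cG gP); ring.
  under eq_bigr do rewrite !sumrB !big_split /=.
  rewrite !sumrB !big_split /=; congr (_ + _ - _ - _).
  - by under eq_bigr do rewrite -mulr_sumr W1 mulr1.
  - by under eq_bigr do rewrite -mulr_sumr; rewrite -mulr_suml W1 mul1r.
  - by apply: eq_bigr => u _; rewrite -mulr_sumr.
  - by rewrite exchange_big; apply: eq_bigr => u _; rewrite -mulr_sumr.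
rewrite /edge_correction !QE /subdivision_green -!/(Q _ _) !eqxx (eq_sym j i).
by case: eqP => [->|_] /=; field; rewrite pnatr_eq0 -lt0n.
Qed.

(** * Sums of weights and corrections *)

Lemma sum_incidence u :
  \sum_(E : {E : {set G} | E \in edges G}) (u \in val E)%:R =
  (degree u)%:R :> R.
Proof.
transitivity (\sum_(v | adj u v) (1 : R)); last by rewrite sumr_const.
rewrite -(sum_incident_edges u (fun=> 1)) [RHS]big_mkcond /=.
by apply: eq_bigr => E _; case: (u \in _).
Qed.

Lemma handshake : \sum_(u : G) (degree u)%:R = 2 * #|edges G|%:R :> R.
Proof.
under eq_bigr do rewrite -sum_incidence.
rewrite exchange_big /= -(card_sig (mem (edges G))) mulr_natr -sumr_const.
apply: eq_bigr => E _; rewrite -(edge_card2 (valP E)) -sum1_card natr_sum.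
by rewrite [RHS]big_mkcond; apply: eq_bigr => u _; case: (u \in _).
Qed.

Lemma sum_weights u :
  \sum_a endpoint_weight a u = 1 + q%:R / 2 * (degree u)%:R.
Proof.
rewrite sum_subdivision; congr (_ + _).
  by under eq_bigr do rewrite /= eq_sym -[_%:R]mulr1; rewrite sum_delta.
rewrite -sum_incidence mulr_sumr; apply: eq_bigr => E _ /=.
by rewrite sumr_const card_ord -mulr_natl; ring.
Qed.

Lemma sum_degree_weights u :
  \sum_a (degree a)%:R * endpoint_weight a u = 2 * q%:R * (degree u)%:R.
Proof.
rewrite sum_subdivision; transitivity
  (q%:R * (degree u)%:R + q%:R * (degree u)%:R : R); last by ring.
congr (_ + _).
  under eq_bigr do rewrite degree_inl /= eq_sym mulrC.
  by rewrite sum_delta natrM.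
rewrite -[in RHS]sum_incidence mulr_sumr; apply: eq_bigr => E _ /=.
under eq_bigr do rewrite degree_inr.
by rewrite sumr_const card_ord -mulr_natl /=; field.
Qed.

(** Counting vertices, and below degrees, amounts to summing the total weights
over [G], since each vertex of [S] has total weight 1. *)
Lemma subdivision_card :
  #|S|%:R = #|G|%:R + #|edges G|%:R * q%:R :> R.
Proof.
transitivity (\sum_(a : S) \sum_u endpoint_weight a u).
  by under eq_bigr do rewrite sum_weight; rewrite sumr_const.
rewrite exchange_big; under eq_bigr do rewrite sum_weights.
by rewrite big_split /= sumr_const -mulr_sumr handshake; field.
Qed.

Lemma subdivision_handshake :
  \sum_(a : S) (degree a)%:R = 4 * #|edges G|%:R * q%:R :> R.
Proof.
transitivity (\sum_(a : S) \sum_u (degree a)%:R * endpoint_weight a u).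
  by apply: eq_bigr => a _; rewrite -mulr_sumr sum_weight mulr1.
rewrite exchange_big; under eq_bigr do rewrite sum_degree_weights.
by rewrite -mulr_sumr handshake; ring.
Qed.

Lemma sum_middle : \sum_a middle a = #|edges G|%:R * q%:R.
Proof.
rewrite sum_subdivision big1 ?add0r //=.
under eq_bigr do rewrite sumr_const card_ord.
by rewrite sumr_const card_sig -mulrnA mulnC natrM.
Qed.

(** Quantities supported on the middle vertices only see the degree 2. *)
Lemma degree_middle a : (degree a)%:R * middle a = 2 * middle a.
Proof. by case: a => [u|x]; rewrite ?degree_inr //= !mulr0. Qed.

Lemma edge_correctionE a : edge_correction a =
  2^-1 * extend (fun u => extend (resistance R u) a) a.
Proof.
congr (_ * _); apply: eq_bigr => u _; rewrite mulr_sumr.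
by apply: eq_bigr => v _; rewrite mulrA.
Qed.

Lemma edge_correction_inl u : connected_graph G -> edge_correction (inl u) = 0.
Proof.
by move=> cG; rewrite edge_correctionE !extend_inl resistance_refl // mulr0.
Qed.

Lemma degree_edge_correction a : connected_graph G ->
  (degree a)%:R * edge_correction a = 2 * edge_correction a.
Proof.
move=> cG; case: a => [u|x]; last by rewrite degree_inr.
by rewrite edge_correction_inl // !mulr0.
Qed.

(** Middle vertices of one edge contribute equally, [q] for each edge, and the
remaining sum over edges is Foster's. *)
Lemma sum_edge_correction : connected_graph G ->
  \sum_a edge_correction a = q%:R / 4 * (#|G|%:R - 1).
Proof.
move=> cG; rewrite sum_subdivision big1 ?add0r => [|u _]; last first.
  exact: edge_correction_inl.
transitivity (q%:R / 8 * \sum_(E : {E : {set G} | E \in edges G})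
    \sum_(u in val E) \sum_(v in val E) resistance R u v).
  rewrite mulr_sumr; apply: eq_bigr => E _.
  under eq_bigr do rewrite edge_correctionE extend_inr /=.
  under eq_bigr do under eq_bigr do rewrite extend_inr /=.
  by rewrite sumr_const card_ord -mulr_natl -mulr_suml; field.
rewrite (exchange_big_dep xpredT) //=.
under eq_bigr => u _ do rewrite
  (sum_incident_edges u (fun E => \sum_(v in E) resistance R u v)).
transitivity (q%:R / 8 * \sum_(u : G) \sum_(v | adj u v) resistance R u v);
  last by rewrite foster //; field.
congr (_ * _); apply: eq_bigr => u _; apply: eq_bigr => v uv.
rewrite big_setU1 ?inE /=; first by rewrite big_set1 resistance_refl // add0r.
by apply: contraTneq uv => ->; rewrite adj_irrefl.
Qed.

End Subdivision.

(** * The additive index of the subdivision graph *)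

Lemma sum_bilinear {R : realType} {S T : finType} (A B : S -> T -> R)
    (r : T -> T -> R) :
  \sum_i \sum_j \sum_u \sum_v A i u * B j v * r u v =
  \sum_u \sum_v (\sum_i A i u) * (\sum_j B j v) * r u v.
Proof.
transitivity (\sum_(p : S * S) \sum_(s : T * T)
    A p.1 s.1 * B p.2 s.2 * r s.1 s.2).
  by rewrite pair_bigA; apply: eq_bigr => p _; rewrite pair_bigA.
rewrite exchange_big [RHS]pair_bigA /=; apply: eq_bigr => s _.
by rewrite big_distrlr pair_bigA mulr_suml.
Qed.

Lemma sum_offdiagonal {R : realType} {T : finType} (d e : T -> R) :
  \sum_i \sum_j d i * ((i != j)%:R * ((e i + e j) / 2)) =
  (#|T|%:R * \sum_i d i * e i + (\sum_i d i) * (\sum_i e i)) / 2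
  - \sum_i d i * e i.
Proof.
have -> : #|T|%:R * (\sum_i d i * e i) = \sum_i \sum_(j : T) d i * e i.
  by rewrite mulr_sumr; apply: eq_bigr => i _; rewrite sumr_const mulr_natl.
rewrite big_distrlr -big_split mulr_suml -sumrB; apply: eq_bigr => i _ /=.
transitivity (\sum_j ((d i * e i + d i * e j) / 2 - (j == i)%:R * (d i * e i))).
  by apply: eq_bigr => j _; case: (eqVneq j i) => [->|_] /=; field.
by rewrite sumrB sum_delta -mulr_suml big_split.
Qed.

Theorem theorem6p5 (R : realType) (q : nat) (G : sgraph) (n m : nat)
    (hq : (1 <= q)%N) (hG : connected_graph G)
    (hn : #|G| = n) (hm : #|edges G| = m) :
  additive_kirchhoff R (subdivision q G) =
    4 * additive_kirchhoff R G + 4 * q%:R * multiplicative_kirchhoff R G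
    + m%:R * q%:R * (3 * m%:R * q%:R - 2 * n%:R + 1) - n%:R * (n%:R - 1).
Proof.
have qN0 : q%:R != 0 :> R by rewrite pnatr_eq0 -lt0n.
set S := subdivision q G.
pose W : S -> G -> R := @endpoint_weight R q G.
pose c : S -> R := @edge_correction R q G.
pose e : S -> R := @middle R q G.
pose d (a : S) : R := (degree a)%:R.
rewrite additive_kirchhoff_ordered; last exact: subdivision_connected.
transitivity (2 / q%:R * (
    \sum_(i : S) \sum_(j : S) \sum_u \sum_v
      (d i * W i u) * W j v * resistance R u v
    - #|S|%:R * (\sum_i d i * c i) - (\sum_i d i) * (\sum_i c i))
  + \sum_i \sum_j d i * ((i != j)%:R * ((e i + e j) / 2))).
  have -> : #|S|%:R * (\sum_i d i * c i) = \sum_i \sum_(j : S) d i * c i.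
    by rewrite mulr_sumr; apply: eq_bigr => i _; rewrite sumr_const mulr_natl.
  rewrite big_distrlr -!sumrB mulr_sumr -big_split; apply: eq_bigr => i _ /=.
  rewrite -!sumrB mulr_sumr -big_split; apply: eq_bigr => j _ /=.
  rewrite subdivision_resistance // mulrDr; congr (_ + _).
  rewrite mulrCA; congr (_ * _); rewrite !mulrBr; congr (_ - _ - _).
  rewrite mulr_sumr; apply: eq_bigr => u _; rewrite mulr_sumr.
  by apply: eq_bigr => v _; rewrite !mulrA.
have -> : \sum_i d i * c i = 2 * \sum_i c i.
  by rewrite mulr_sumr; apply: eq_bigr => i _; apply: degree_edge_correction.
rewrite sum_offdiagonal (sum_bilinear (fun i u => d i * W i u)).
have -> : \sum_i d i * e i = 2 * \sum_i e i.
  by rewrite mulr_sumr; apply: eq_bigr => i _; apply: degree_middle.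
rewrite sum_middle sum_edge_correction // subdivision_handshake.
rewrite subdivision_card hm hn.
(* 2 q d_u (1 + q d_v / 2) splits into the weights of the two indices. *)
have -> : \sum_u \sum_v (\sum_i d i * W i u) * (\sum_j W j v) * resistance R u v
   = 2 * q%:R * additive_kirchhoff R G
     + 2 * q%:R ^+ 2 * multiplicative_kirchhoff R G.
  transitivity (2 * q%:R * additive_kirchhoff R G
     + q%:R ^+ 2 * (2 * multiplicative_kirchhoff R G)); last by ring.
  rewrite additive_kirchhoff_ordered // multiplicative_kirchhoff_ordered //.
  rewrite !mulr_sumr -big_split; apply: eq_bigr => u _ /=.
  rewrite !mulr_sumr -big_split; apply: eq_bigr => v _ /=.
  by rewrite sum_degree_weights sum_weights; field.
by field.
Qed.
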